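(* Suppose that $\{X_n\}$ is a sequence of uniformly bounded complete $\mathrm{CAT}(0)$ spaces that converges to the complete $\mathrm{CAT}(0)$ space $X$, and that $u_n:X_n\to\mathbb{R}$ is a sequence of uniformly bounded non-negative functions that converges to the non-negative function $u:X\to\mathbb{R}$, where none of the functions $u_n$, $u$ is identically $0$. Let $q_n$ be the barycenter of $X_n$ relative to $u_n$ and let $q_u$ be the barycenter of $X$ relative to $u$. Then $\lim_{n\to\infty}q_n=q_u$.
   Context: Barycenter: for a bounded complete $\mathrm{CAT}(0)$ space $Y$ and a bounded non-negative function $v:Y\to\mathbb{R}$, not identically $0$, the barycenter of $Y$ relative to $v$ is the point $q\in Y$ (which exists and is unique) such that $\sup\{v(p)d(q,p)\mid p\in Y\}=\inf_{x\in Y}\sup\{v(p)d(x,p)\mid p\in Y\}$. Uniformly bounded: $\{X_n\}$ is uniformly bounded if there is $b>0$ with $\mathrm{diam}(X_n)<b$ for all $n$; $\{u_n\}$ is uniformly bounded if there is $m>0$ with $|u_n(x)|\le m$ for all $n$ and $x\in X_n$. Resolutions: for subsets $A,B$ of a metric space $Z$, $d_H(A,B)=\inf\{\epsilon\mid A\subseteq U_\epsilon(B),\ B\subseteq U_\epsilon(A)\}$ is the Hausdorff distance, where $U_\epsilon(A)=\{z\in Z\mid d(z,A)<\epsilon\}$. A $\delta$-resolution $R(X,Y,Z,\delta)$ of metric spaces $X$ and $Y$ consists of a metric space $Z$ and isometric embeddings $i_1:X\to Z$, $i_2:Y\to Z$ with $d_H(i_1(X),i_2(Y))<\delta$; one identifies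 $X$ with $i_1(X)$ and $Y$ with $i_2(Y)$, as subsets of $Z$. The Gromov-Hausdorff distance is $d_{GH}(X,Y)=\inf\{\delta\mid \text{there is a }\delta\text{-resolution of }X\text{ and }Y\}$. Convergence: $\{X_n\}$ converges to $X$ if $\lim_{n\to\infty} d_{GH}(X_n,X)=0$. The functions $u_n:X_n\to\mathbb{R}$ converge to $u:X\to\mathbb{R}$ if there is a sequence of resolutions $R(X_n,X,Z_n,\delta_n)$ with $\lim_{n\to\infty}\delta_n=0$ such that for every $\epsilon>0$ there is $N>0$ such that if $n>N$, $x_n\in X_n\subseteq Z_n$, $x\in X\subseteq Z_n$ and $d(x_n,x)<\delta_n$, then $|u_n(x_n)-u(x)|<\epsilon$. Points $q_n\in X_n$ converge to $q\in X$ (written $\lim_{n\to\infty}q_n=q$) if there is a sequence of resolutions $R(X_n,X,Z_n,\delta_n)$ with $\lim_{n\to\infty}\delta_n=0$ such that for every $s>0$ there is $N>0$ such that for $n>N$ the ball $B(q,s)$ in $Z_n$ contains $q_n$. *)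

(* Defs.v *)
From HB Require Import structures.
From mathcomp Require Import all_boot all_order all_algebra.
From mathcomp Require Import all_classical all_reals all_analysis.

Set Implicit Arguments.
Unset Strict Implicit.
Unset Printing Implicit Defensive.

Import Order.TTheory GRing.Theory Num.Theory.
Import numFieldNormedType.Exports.

Local Open Scope classical_set_scope.
Local Open Scope ring_scope.

Section Metric.
Context {R : realType}.

Definition complete_metric (T : metricType R) : Prop :=
  forall u : nat -> T, cauchy (u @ \oo) -> exists l : T, u @ \oo --> l.

Definition diam (T : metricType R) : \bar R :=
  ereal_sup [set d | exists x y : T, d = (mdist x y)%:E].

Definition isometric_embedding (S T : metricType R) (f : S -> T) : Prop :=
  forall x y : S, mdist (f x) (f y) = mdist x y.

End Metric.

Section CAT0.
Context {R : realType}.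

(* The norm the library puts on 'rV[R]_2 is the sup norm, so the Euclidean
   distance of the comparison plane is written out. *)
Definition plane_dist (a b : 'rV[R]_2) : R :=
  Num.sqrt (\sum_(k < 2) (a ord0 k - b ord0 k) ^+ 2).

Definition plane_segment (a b : 'rV[R]_2) : set 'rV[R]_2 :=
  [set (1 - t) *: a + t *: b | t in `[0, 1]].

(* Only the values of g on [0, d(x, y)] matter. *)
Definition is_geodesic (T : metricType R) (x y : T) (g : R -> T) : Prop :=
  [/\ g 0 = x, g (mdist x y) = y
    & {in `[0, mdist x y] &, forall s t, mdist (g s) (g t) = `|s - t|}].

Definition geodesic_space (T : metricType R) : Prop :=
  forall x y : T, exists g : R -> T, is_geodesic x y g.

(* Vertices and sides are indexed cyclically by 'I_3, the i-th side running
   from v i to v (ordS i). *)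
Definition geodesic_triangle (T : metricType R)
    (v : 'I_3 -> T) (g : 'I_3 -> R -> T) : Prop :=
  forall i, is_geodesic (v i) (v (ordS i)) (g i).

Definition comparison_triangle (T : metricType R)
    (v : 'I_3 -> T) (w : 'I_3 -> 'rV[R]_2) : Prop :=
  forall i, plane_dist (w i) (w (ordS i)) = mdist (v i) (v (ordS i)).

(* p is the comparison point of g i s, the point of the i-th side at distance
   s from v i. *)
Definition comparison_point (w : 'I_3 -> 'rV[R]_2) (i : 'I_3) (s : R)
    (p : 'rV[R]_2) : Prop :=
  plane_segment (w i) (w (ordS i)) p /\ plane_dist (w i) p = s.

Definition CAT0 (T : metricType R) : Prop :=
  geodesic_space T /\
  forall (v : 'I_3 -> T) (g : 'I_3 -> R -> T) (w : 'I_3 -> 'rV[R]_2),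
    geodesic_triangle v g -> comparison_triangle v w ->
    forall (i j : 'I_3) (s t : R) (p q : 'rV[R]_2),
      s \in `[0, mdist (v i) (v (ordS i))] ->
      t \in `[0, mdist (v j) (v (ordS j))] ->
      comparison_point w i s p -> comparison_point w j t q ->
      mdist (g i s) (g j t) <= plane_dist p q.

End CAT0.

Section Barycenter.
Context {R : realType}.

Definition weighted_radius (Y : metricType R) (v : Y -> R) (x : Y) : \bar R :=
  ereal_sup (range (fun p : Y => (v p * mdist x p)%:E)).

(* When Y is a bounded complete CAT(0) space and v is bounded, non-negative and
   not identically 0, there is exactly one such q. *)
Definition is_barycenter (Y : metricType R) (v : Y -> R) (q : Y) : Prop :=
  weighted_radius v q = ereal_inf (range (weighted_radius v)).

End Barycenter.

Section GromovHausdorff.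
Context {R : realType}.

Definition thickening (Z : metricType R) (e : R) (A : set Z) : set Z :=
  [set z | (edist_inf A z < e%:E)%E].

Definition hausdorff_dist (Z : metricType R) (A B : set Z) : \bar R :=
  ereal_inf (EFin @`
    [set e : R | A `<=` thickening e B /\ B `<=` thickening e A]).

Record resolution (X Y : metricType R) (delta : R) := Resolution {
  res_space : metricType R ;
  res_left : X -> res_space ;
  res_right : Y -> res_space ;
  res_left_isometric : isometric_embedding res_left ;
  res_right_isometric : isometric_embedding res_right ;
  res_close : (hausdorff_dist (range res_left) (range res_right) < delta%:E)%E
}.

(* Extended-valued, so that the infimum is +oo when there is no resolution. *)
Definition dist_GH (X Y : metricType R) : \bar R :=
  ereal_inf (EFin @` [set delta : R | inhabited (resolution X Y delta)]).

Definition converges_GH (X_ : nat -> metricType R) (X : metricType R) : Prop :=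
  dist_GH (X_ n) X @[n --> \oo] --> 0%E.

Definition functions_converge (X_ : nat -> metricType R) (X : metricType R)
    (u_ : forall n, X_ n -> R) (u : X -> R) : Prop :=
  exists (delta : nat -> R) (r : forall n, resolution (X_ n) X (delta n)),
    delta @ \oo --> (0 : R) /\
    forall e : R, 0 < e -> exists N : nat, forall n, (N < n)%N ->
      forall (xn : X_ n) (x : X),
        mdist (res_left (r n) xn) (res_right (r n) x) < delta n ->
        `|u_ n xn - u x| < e.

Definition points_converge (X_ : nat -> metricType R) (X : metricType R)
    (q_ : forall n, X_ n) (q : X) : Prop :=
  exists (delta : nat -> R) (r : forall n, resolution (X_ n) X (delta n)),
    delta @ \oo --> (0 : R) /\
    forall s : R, 0 < s -> exists N : nat, forall n, (N < n)%N ->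
      ball (res_right (r n) q) s (res_left (r n) (q_ n)).

Definition spaces_uniformly_bounded (X_ : nat -> metricType R) : Prop :=
  exists2 b : R, 0 < b & forall n, (diam (X_ n) < b%:E)%E.

Definition functions_uniformly_bounded (X_ : nat -> metricType R)
    (u_ : forall n, X_ n -> R) : Prop :=
  exists2 m : R, 0 < m & forall n (x : X_ n), `|u_ n x| <= m.

End GromovHausdorff.

(* Main.v *)
Require Import Defs.
From HB Require Import structures.
From mathcomp Require Import all_boot all_order all_algebra.
From mathcomp Require Import all_classical all_reals all_analysis.
From mathcomp Require Import ring lra.

Set Implicit Arguments.
Unset Strict Implicit.
Unset Printing Implicit Defensive.

Import Order.TTheory GRing.Theory Num.Theory.
Import numFieldNormedType.Exports.

Local Open Scope classical_set_scope.
Local Open Scope ring_scope.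

(** The barycenter minimizes the weighted radius
    rho_u (x) = sup_p u(p) d(x, p).  Two facts give the convergence.

    Transfer ([weighted_radius_transfer]).  Inside a fine resolution, every
    p in X has a partner p_n in X_n at distance less than delta_n with
    |u_n (p_n) - u(p)| small; hence, as all the distances and weights are
    bounded, the radii rho_u and rho_(u_n) at two points less than delta_n apart
    differ by little.  Let y in X be close to q_n, and let x_n in X_n be close
    to q_u.  Up to small errors,
      rho_u (y) <= rho_(u_n) (q_n) <= rho_(u_n) (x_n) <= rho_u (q_u),
    so y nearly minimizes rho_u.

    Stability ([barycenter_stable]).  In a CAT(0) space a near minimizer of
    rho_u is close to the barycenter q_u: if y is one and m is the midpoint of
    y and q_u, the inequality
      d(m, p)^2 <= (d(y, p)^2 + d(q_u, p)^2) / 2 - d(y, q_u)^2 / 4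
    of [CAT0_midpoint], multiplied by u(p)^2, makes rho_u (m) smaller than the
    minimum unless d(y, q_u) is small.  Only the points p that nearly realize
    rho_u (m) matter, and there u(p) is bounded below because X is bounded and
    the minimum is positive.  A minimum equal to 0 forces u to vanish outside
    q_u; then rho_u (y) is at least u(q_u) d(y, q_u) with u(q_u) > 0.

    So d(q_n, q_u) <= d(q_n, y) + d(y, q_u) tends to 0, in the very resolutions
    along which u_n converges to u. *)

(** * Triangles in the Euclidean plane *)

Section Plane.
Context {R : realType}.
Implicit Types a b p : 'rV[R]_2.

Lemma plane_dist_sqr a b :
  plane_dist a b ^+ 2 = \sum_(k < 2) (a ord0 k - b ord0 k) ^+ 2.
Proof. by rewrite sqr_sqrtr// sumr_ge0// => k _; exact: sqr_ge0. Qed.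

Lemma plane_dist_eq a b (d : R) : 0 <= d ->
  \sum_(k < 2) (a ord0 k - b ord0 k) ^+ 2 = d ^+ 2 -> plane_dist a b = d.
Proof. by move=> d0; rewrite /plane_dist => ->; rewrite sqrtr_sqr ger0_norm. Qed.

Lemma plane_distC a b : plane_dist a b = plane_dist b a.
Proof.
rewrite /plane_dist; congr Num.sqrt.
by apply: eq_bigr => k _; rewrite -sqrrN opprB.
Qed.

(** The coefficients are those of the parameter 1/2 in [plane_segment]. *)
Definition plane_midpoint a b : 'rV[R]_2 := (1 - 2^-1) *: a + 2^-1 *: b.

Lemma plane_dist_midpoint a b :
  plane_dist a (plane_midpoint a b) = plane_dist a b / 2.
Proof.
apply: plane_dist_eq; first by rewrite divr_ge0 ?sqrtr_ge0.
rewrite expr_div_n plane_dist_sqr mulr_suml; apply: eq_bigr => k _.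
by rewrite !mxE; field.
Qed.

Lemma plane_median a b p : plane_dist (plane_midpoint a b) p ^+ 2 =
  (plane_dist a p ^+ 2 + plane_dist b p ^+ 2) / 2 - plane_dist a b ^+ 2 / 4.
Proof.
rewrite !plane_dist_sqr !mulr_suml -big_split/= !mulr_suml -sumrB.
by apply: eq_bigr => k _; rewrite !mxE; field.
Qed.

(** Two vertices are put at (0, 0) and (c, 0); the law of cosines then forces
    the abscissa x of the third one, and Heron's factorization of
    4 c^2 (b^2 - x^2) into four nonnegative terms makes its ordinate real. *)
Lemma plane_triangle (a b c : R) : 0 <= a -> 0 <= b -> 0 <= c ->
  a <= b + c -> b <= c + a -> c <= a + b ->
  exists w : 'I_3 -> 'rV[R]_2,
    [/\ plane_dist (w ord0) (w (ordS ord0)) = c,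
        plane_dist (w (ordS ord0)) (w (ordS (ordS ord0))) = a
      & plane_dist (w (ordS (ordS ord0))) (w ord0) = b].
Proof.
move=> a0 b0 c0 abc bca cab.
pose x : R := (b ^+ 2 + c ^+ 2 - a ^+ 2) / (2 * c).
pose y : R := Num.sqrt (b ^+ 2 - x ^+ 2).
pose pt (s t : R) : 'rV[R]_2 := \row_k [:: s; t]`_k.
exists (fun i : 'I_3 => [:: pt 0 0; pt c 0; pt x y]`_i) => /=.
(* If c = 0 then x = 0 because division by 0 gives 0, and any third vertex at
   distance b = a will do. *)
have xc : 2 * x * c = b ^+ 2 + c ^+ 2 - a ^+ 2.
  rewrite /x; have [c_eq0|c_neq0] := eqVneq c 0; last by field.
  have -> : a = b by lra.
  rewrite c_eq0; ring.
have yE : y ^+ 2 = b ^+ 2 - x ^+ 2.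
  rewrite sqr_sqrtr//.
  have [c_eq0|c_neq0] := eqVneq c 0.
    by rewrite /x c_eq0 mulr0 invr0 mulr0 expr0n subr0 sqr_ge0.
  have c2 : 0 < 4 * c ^+ 2 by rewrite mulr_gt0// exprn_gt0// lt_def c_neq0.
  rewrite -(pmulr_rge0 _ c2).
  have -> : 4 * c ^+ 2 * (b ^+ 2 - x ^+ 2)
      = ((b + c - a) * (b + c + a)) * ((a - b + c) * (a + b - c)).
    transitivity (4 * c ^+ 2 * b ^+ 2 - (2 * x * c) ^+ 2); first ring.
    rewrite xc; ring.
  by rewrite !mulr_ge0//; lra.
split; apply: plane_dist_eq => //; rewrite !big_ord_recl big_ord0 !mxE/=.
- ring.
- transitivity (c ^+ 2 - 2 * x * c + x ^+ 2 + y ^+ 2); first ring.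
  rewrite yE xc; ring.
- transitivity (x ^+ 2 + y ^+ 2); first ring.
  by rewrite yE; ring.
Qed.

End Plane.

(** * The midpoint inequality of CAT(0) spaces *)

Section Cat0.
Context {R : realType}.

(** The comparison is between the midpoint of the side from x to y and the
    opposite vertex p: in the plane the right-hand side is exactly the squared
    length of the median. The midpoint m is chosen before p. *)
Lemma CAT0_midpoint (T : metricType R) : CAT0 T -> forall x y : T,
  exists m : T, forall p : T, mdist m p ^+ 2 <=
    (mdist x p ^+ 2 + mdist y p ^+ 2) / 2 - mdist x y ^+ 2 / 4.
Proof.
move=> [geoT cmpT] x y; have [gxy gxyP] := geoT x y.
exists (gxy (mdist x y / 2)) => p.
have [gyp gypP] := geoT y p; have [gpx gpxP] := geoT p x.
pose v (i : 'I_3) : T := nth x [:: x; y; p] i.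
pose g (i : 'I_3) : R -> T := nth gxy [:: gxy; gyp; gpx] i.
have [w [w01 w12 w20]] : exists w : 'I_3 -> 'rV[R]_2,
    [/\ plane_dist (w ord0) (w (ordS ord0)) = mdist x y,
        plane_dist (w (ordS ord0)) (w (ordS (ordS ord0))) = mdist y p
      & plane_dist (w (ordS (ordS ord0))) (w ord0) = mdist p x].
  apply: plane_triangle; rewrite ?mdist_ge0//.
  - have := metric_triangle y x p.
    by rewrite (metric_sym y x) (metric_sym x p) addrC.
  - have := metric_triangle p y x.
    by rewrite (metric_sym p y) (metric_sym y x) addrC.
  - have := metric_triangle x p y.
    by rewrite (metric_sym x p) (metric_sym p y) addrC.
have c0 : 0 <= mdist x y by exact: mdist_ge0.
pose i2 : 'I_3 := ordS (ordS ord0).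
have i2S : ordS i2 = ord0 by apply/val_inj.
have tri : geodesic_triangle v g.
  move=> [[|[|[|//]]] ?]; rewrite /v /g /=;
    [exact: gxyP|exact: gypP|exact: gpxP].
have cmp : comparison_triangle v w.
  move=> i; have : i \in [:: ord0; ordS ord0; i2].
    by rewrite !inE -!val_eqE /=; case: i => [[|[|[|]]]].
  by rewrite !inE => /or3P[] /eqP ->; rewrite /v /= ?i2S.
have gpx0 : gpx 0 = p by case: gpxP.
have le_med : mdist (gxy (mdist x y / 2)) (gpx 0) <=
    plane_dist (plane_midpoint (w ord0) (w (ordS ord0))) (w i2).
  apply: (cmpT v g w tri cmp ord0 i2); rewrite /v /=.
  - by rewrite in_itv/=; apply/andP; split; lra.
  - by rewrite in_itv/= lexx mdist_ge0.
  - split; last by rewrite plane_dist_midpoint w01.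
    by exists 2^-1 => //=; rewrite in_itv/=; apply/andP; split; lra.
  - split; last first.
      apply: plane_dist_eq => //; rewrite expr0n big1// => k _.
      by rewrite subrr expr0n.
    exists 0; first by rewrite /= in_itv/= lexx ler01.
    by rewrite subr0 scale1r scale0r addr0.
rewrite gpx0 in le_med.
apply: (le_trans (y :=
  plane_dist (plane_midpoint (w ord0) (w (ordS ord0))) (w i2) ^+ 2)).
  by rewrite lerXn2r ?nnegrE ?mdist_ge0 ?sqrtr_ge0.
rewrite plane_median.
by rewrite w01 w12 (plane_distC (w ord0)) w20 (metric_sym p).
Qed.

End Cat0.

(** * Stability of the barycenter *)

Section WeightedRadius.
Context {R : realType}.

Lemma weighted_radius_ub (X : metricType R) (u : X -> R) (x p : X) :
  ((u p * mdist x p)%:E <= weighted_radius u x)%E.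
Proof. by apply: ereal_sup_ubound; exists p. Qed.

Lemma barycenter_le (X : metricType R) (u : X -> R) (q x : X) :
  is_barycenter u q -> (weighted_radius u q <= weighted_radius u x)%E.
Proof. by move=> ->; apply: ereal_inf_lbound; exists x. Qed.

(** Strict convexity of squared distances makes the minimizer of the weighted
    radius quantitatively unique. Let r be the radius at q, y a point of radius
    at most r + eta, and m the midpoint of y and q. As m has radius at least r,
    some p has u p * d(m, p) > r - eta; the midpoint inequality at p times
    t ^+ 2, with t := u p, gives
      (r - eta)^2 < ((r + eta)^2 + r^2) / 2 - (t d(y, q))^2 / 4,
    so (t d(y, q))^2 is of order r * eta, while t is bounded below by
    c = r / (2 D). *)
Lemma barycenter_stable (X : metricType R) (u : X -> R) (q : X) (D M : R) :
  CAT0 X -> (forall x y : X, mdist x y <= D) ->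
  (forall x, 0 <= u x) -> (forall x, u x <= M) -> (exists x, u x <> 0) ->
  is_barycenter u q ->
  forall s : R, 0 < s -> exists2 eta : R, 0 < eta & forall y,
    (weighted_radius u y <= weighted_radius u q + eta%:E)%E -> mdist y q < s.
Proof.
move=> catX leD u0 leM [x0 /eqP ux0] qP s s0.
have D0 : 0 <= D by apply: le_trans (leD q q); exact: mdist_ge0.
pose r := fine (weighted_radius u q).
have rE : weighted_radius u q = r%:E.
  rewrite /r fineK// ge0_fin_numE.
    apply: (@le_lt_trans _ _ (M * D)%:E); last exact: ltry.
    apply: ge_ereal_sup => _ [p _ <-]; rewrite lee_fin.
    by rewrite ler_pM ?mdist_ge0.
  by apply: le_trans (weighted_radius_ub u q q); rewrite mdistxx mulr0.
have r_ub p : u p * mdist q p <= r by rewrite -lee_fin -rE weighted_radius_ub.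
have r_ge0 : 0 <= r by rewrite -(mulr0 (u q)) -[X in _ * X](mdistxx q).
rewrite rE.
(* If r = 0 then q is the only point where u does not vanish, and the term
   p = q of the radius at y already controls the distance. *)
have [r_eq0|r_neq0] := eqVneq r 0.
  have x0q : q = x0.
    apply: mdist_positivity; apply/eqP.
    have := r_ub x0; rewrite r_eq0 => le0.
    have : u x0 * mdist q x0 == 0 by rewrite eq_le le0 mulr_ge0// mdist_ge0.
    by rewrite mulf_eq0 (negPf ux0).
  have uq0 : 0 < u q by rewrite lt_def u0 x0q ux0.
  exists (u q * (s / 2)); first by rewrite mulr_gt0// divr_gt0.
  move=> y; rewrite r_eq0 add0e => /(le_trans (weighted_radius_ub u y q)).
  by rewrite lee_fin ler_pM2l// => le_s2; lra.
have r_gt0 : 0 < r by rewrite lt_def r_neq0.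
have D_gt0 : 0 < D.
  rewrite lt_def D0 andbT; apply: contraNneq r_neq0 => D_eq0.
  suff : weighted_radius u q = 0%:E by rewrite rE => -[->].
  apply/eqP; rewrite eq_le; apply/andP; split; last by rewrite rE lee_fin.
  apply: ge_ereal_sup => _ [p _ <-]; rewrite lee_fin.
  by rewrite mulr_ge0_le0// -D_eq0.
pose c := r / (2 * D).
have c0 : 0 < c by rewrite divr_gt0// mulr_gt0.
(* The first bound makes r - eta at least r / 2, whence t > c; with the second,
   16 r eta <= (c s)^2 / 2 < (t s)^2 absorbs the error of the midpoint
   inequality. *)
pose eta := Num.min (r / 2) (c ^+ 2 * s ^+ 2 / (32 * r)).
have eta0 : 0 < eta.
  by rewrite lt_min !divr_gt0// mulr_gt0// exprn_gt0.
have eta_r : eta <= r / 2 by rewrite ge_min lexx.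
have eta_s : 32 * r * eta <= c ^+ 2 * s ^+ 2.
  have h : eta <= c ^+ 2 * s ^+ 2 / (32 * r) by rewrite ge_min lexx orbT.
  by rewrite mulrC -ler_pdivlMr// mulr_gt0.
exists eta => // y le_y.
have [m mP] := CAT0_midpoint catX y q.
have : ((r - eta)%:E < weighted_radius u m)%E.
  apply: (@lt_le_trans _ _ r%:E); first by rewrite lte_fin; lra.
  by rewrite -rE; exact: barycenter_le.
case/ereal_sup_gt => _ [p _ <-]; rewrite lte_fin => lt_p.
set t := u p in lt_p; have t0 : 0 <= t by exact: u0.
have le_yp : t * mdist y p <= r + eta.
  by rewrite -lee_fin EFinD (le_trans _ le_y)// weighted_radius_ub.
have le_qp : t * mdist q p <= r by exact: r_ub.
have lt_c : c < t.
  rewrite /c ltr_pdivrMr ?mulr_gt0//.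
  have : t * mdist m p <= t * D by rewrite ler_wpM2l.
  by nra.
clearbody eta c.
have lt_sq : (r - eta) ^+ 2 < (t * mdist m p) ^+ 2.
  by rewrite ltrXn2r ?nnegrE//; nra.
have yp_sq : (t * mdist y p) ^+ 2 <= (r + eta) ^+ 2.
  by rewrite lerXn2r ?nnegrE ?mulr_ge0 ?mdist_ge0 ?addr_ge0// ltW.
have qp_sq : (t * mdist q p) ^+ 2 <= r ^+ 2.
  by rewrite lerXn2r ?nnegrE ?mulr_ge0 ?mdist_ge0.
have mid := ler_wpM2l (sqr_ge0 t) (mP p).
have key : (t * mdist y q) ^+ 2 < (t * s) ^+ 2.
  have lt_cs : c ^+ 2 * s ^+ 2 < (t * s) ^+ 2.
    rewrite exprMn ltr_pM2r ?exprn_gt0//.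
    by rewrite ltrXn2r ?nnegrE ?ltW//.
  have : eta ^+ 2 <= r * eta / 2 by nra.
  rewrite !exprMn in lt_sq yp_sq qp_sq lt_cs *; nra.
have ltts : t * mdist y q < t * s.
  by rewrite -(ltr_pXn2r (n := 2)) ?nnegrE ?mulr_ge0 ?mdist_ge0 ?(ltW s0).
by rewrite -(ltr_pM2l (lt_trans c0 lt_c)).
Qed.

End WeightedRadius.

(** * Radii of nearby points in a common space *)

Section Transfer.
Context {R : realType}.

(** For p' a partner of p, replacing u p' * d(a, p') by v p * d(b, p) changes
    the distance by at most 2 delta, weighted by at most M, and the weight by at
    most e, times a distance at most D. The two spaces play symmetric roles up
    to the choice of bounds, so that exchanging them gives the reverse
    comparison. *)
Lemma weighted_radius_transfer (A B Z : metricType R) (f : A -> Z) (g : B -> Z)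
    (u : A -> R) (v : B -> R) (delta e D M : R) :
  isometric_embedding f -> isometric_embedding g ->
  (forall b, exists a, mdist (f a) (g b) < delta) ->
  (forall a b, mdist (f a) (g b) < delta -> `|u a - v b| <= e) ->
  (forall b b' : B, mdist b b' <= D) ->
  (forall a, 0 <= u a) -> (forall a, u a <= M) ->
  forall a b, mdist (f a) (g b) < delta ->
  (weighted_radius v b <=
     weighted_radius u a + (e * D + M * (2 * delta))%:E)%E.
Proof.
move=> isof isog nearB uv leD u0 leM a b ab.
apply: ge_ereal_sup => _ [b' _ <-].
have [a' ab'] := nearB b'.
apply: (@le_trans _ _ ((u a' * mdist a a')%:E + (e * D + M * (2 * delta))%:E)%E);
  last by rewrite leeD2r// weighted_radius_ub.
rewrite -EFinD lee_fin.
have dbb' : mdist b b' <= mdist a a' + 2 * delta.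
  have := metric_triangle (g b) (f a) (g b').
  have := metric_triangle (f a) (f a') (g b').
  rewrite (metric_sym (g b) (f a)) isof isog; lra.
have dle : mdist b b' <= D by [].
have := uv _ _ ab'; rewrite ler_norml => /andP[lo hi].
have := u0 a'; have := leM a'; have := mdist_ge0 b b'.
have := mdist_ge0 (f a') (g b').
have := normr_ge0 (u a' - v b'); have := uv _ _ ab'.
nra.
Qed.

End Transfer.

(** * Partners in a resolution *)

Section Resolution.
Context {R : realType}.

Lemma thickening_near (Z : metricType R) (T : Type) (h : T -> Z) (e : R) (z : Z) :
  thickening e (range h) z -> exists t, mdist (h t) z < e.
Proof.
case/ereal_inf_lt => _ [_ [t _ <-] <-] /edist_lt_ball.
by rewrite ballEmdist/= metric_sym; exists t.
Qed.

Lemma resolution_near (X Y : metricType R) (delta : R) (r : resolution X Y delta) :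
  (forall x, exists y, mdist (res_left r x) (res_right r y) < delta) /\
  (forall y, exists x, mdist (res_left r x) (res_right r y) < delta).
Proof.
have [_ [e [XY YX] <-]] := ereal_inf_lt (res_close r).
rewrite lte_fin => lt_e; split=> z.
  have [|t lt_t] := @thickening_near _ _ (res_right r) e (res_left r z).
    by apply: XY; exists z.
  by exists t; rewrite metric_sym (lt_trans lt_t).
have [|t lt_t] := @thickening_near _ _ (res_left r) e (res_right r z).
  by apply: YX; exists z.
by exists t; rewrite (lt_trans lt_t).
Qed.

End Resolution.

(** * Convergence of barycenters *)

Theorem theorem3 (R : realType)
    (X_ : nat -> metricType R) (X : metricType R)
    (u_ : forall n : nat, X_ n -> R) (u : X -> R)
    (q_ : forall n : nat, X_ n) (q_u : X) :
  spaces_uniformly_bounded X_ ->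
  (forall n, complete_metric (X_ n) /\ CAT0 (X_ n)) ->
  complete_metric X /\ CAT0 X ->
  converges_GH X_ X ->
  functions_uniformly_bounded u_ ->
  (forall n (x : X_ n), 0 <= u_ n x) ->
  (forall x : X, 0 <= u x) ->
  functions_converge u_ u ->
  (forall n, exists x : X_ n, u_ n x <> 0) ->
  (exists x : X, u x <> 0) ->
  (forall n, is_barycenter (u_ n) (q_ n)) ->
  is_barycenter u q_u ->
  points_converge q_ q_u.
Proof.
move=> [b b0 diam_b] _ [_ catX] _ [m m0 leM] un0 u0 [delta [r [delta0 cvg_u]]].
move=> _ u_neq0 q_bary qu_bary.
have leb n (x y : X_ n) : mdist x y <= b.
  rewrite -lee_fin ltW// (le_lt_trans _ (diam_b n))//.
  by apply: ereal_sup_ubound; exists x, y.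
have leMn n x : u_ n x <= m by rewrite (le_trans (ler_norm _)).
have eventually_fine (e : R) : 0 < e -> exists N, forall n, (N < n)%N ->
    delta n < e /\ forall xn x,
      mdist (res_left (r n) xn) (res_right (r n) x) < delta n ->
      `|u_ n xn - u x| <= e.
  move=> e0; have [N1 N1P] := cvg_u e e0.
  have [N2 _ N2P] := cvgr_lt _ delta0 _ e0.
  exists (maxn N1 N2) => n; rewrite gtn_max => /andP[ltN1 ltN2]; split.
    by apply: N2P; exact: ltnW.
  by move=> xn x close; apply/ltW/N1P.
have isol n := res_left_isometric (r n); have isor n := res_right_isometric (r n).
(* One resolution of size less than 1 bounds the diameter of X and u. *)
have [N1 N1P] := eventually_fine 1 ltr01.
have [delta1 close1] := N1P _ (ltnSn N1).
have [_ nearr] := resolution_near (r N1.+1).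
have leD (x y : X) : mdist x y <= b + 2.
  have [xn xnx] := nearr x; have [yn yny] := nearr y.
  have := metric_triangle (res_right (r N1.+1) x) (res_left (r N1.+1) xn)
    (res_right (r N1.+1) y).
  have := metric_triangle (res_left (r N1.+1) xn) (res_left (r N1.+1) yn)
    (res_right (r N1.+1) y).
  rewrite (metric_sym (res_right (r N1.+1) x) (res_left _ _)) isol isor.
  have := leb _ xn yn; lra.
have leMu x : u x <= m + 1.
  have [xn /close1] := nearr x; rewrite ler_norml => /andP[lo hi].
  have := leMn _ xn; lra.
exists delta, r; split=> // s s0.
have s20 : 0 < s / 2 by rewrite divr_gt0.
have [eta eta0 stable] :=
  barycenter_stable catX leD u0 leMu u_neq0 qu_bary s20.
(* C e bounds the error of a transfer when the functions vary by at most e and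
   delta n < e; two transfers may cost eta in total. *)
pose C := b + 2 + (m + 1) * 2.
have C0 : 0 < C by rewrite /C; lra.
pose e := Num.min (s / 2) (eta / (2 * C)).
have e0 : 0 < e by rewrite lt_min s20 divr_gt0// mulr_gt0.
have [N NP] := eventually_fine e e0.
exists N => n /NP[lt_delta close].
have [nearl' nearr'] := resolution_near (r n).
have [y qy] := nearl' (q_ n); have [xn xnq] := nearr' q_u.
have delta_ge0 : 0 <= delta n by rewrite (le_trans _ (ltW qy))// mdist_ge0.
have errC : e * (b + 2) + (m + 1) * (2 * delta n) <= eta / 2.
  have : e * C <= eta / 2.
    have : e <= eta / (2 * C) by rewrite ge_min lexx orbT.
    rewrite ler_pdivlMr ?mulr_gt0// => le_eta.
    by rewrite ler_pdivlMr// -mulrA (mulrC C).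
  rewrite /C; nra.
have rad_y : (weighted_radius u y <=
    weighted_radius (u_ n) (q_ n) + (eta / 2)%:E)%E.
  have leMn1 xn' : u_ n xn' <= m + 1 by have := leMn _ xn'; lra.
  apply: le_trans (weighted_radius_transfer (isol n) (isor n) nearr' close leD
    (un0 n) leMn1 qy) _.
  by rewrite leeD2l// lee_fin.
have rad_xn : (weighted_radius (u_ n) xn <=
    weighted_radius u q_u + (eta / 2)%:E)%E.
  have nearl'' xn' :
      exists x, mdist (res_right (r n) x) (res_left (r n) xn') < delta n.
    by have [x close_x] := nearl' xn'; exists x; rewrite metric_sym.
  have close' x xn' : mdist (res_right (r n) x) (res_left (r n) xn') < delta n ->
      `|u x - u_ n xn'| <= e.
    by rewrite metric_sym distrC; exact: close.
  have lebn (xn' yn' : X_ n) : mdist xn' yn' <= b + 2.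
    by have := leb _ xn' yn'; lra.
  rewrite metric_sym in xnq.
  apply: le_trans (weighted_radius_transfer (isor n) (isol n) nearl'' close' lebn
    u0 leMu xnq) _.
  by rewrite leeD2l// lee_fin.
have yq : mdist y q_u < s / 2.
  apply: stable; apply: (le_trans rad_y).
  rewrite [eta in leRHS]splitr EFinD addeA leeD2r//.
  by apply: le_trans rad_xn; exact: barycenter_le.
have := metric_triangle (res_left (r n) (q_ n)) (res_right (r n) y)
  (res_right (r n) q_u).
have e_s : e <= s / 2 by rewrite ge_min lexx.
rewrite ballEmdist/= metric_sym isor; lra.
Qed.
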